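(* Let $p\ge 1$ be an integer, $q=2^p$, let $\theta\in\mathbb{Z}_q$ be a target label and let $r\geq 2$ be an integer. Let $x_1,\dots,x_r\in\{0,1\}$ be independent uniform bits and put $s_i=(-1)^{x_i}\in\{-1,+1\}$. Let $\alpha_1,\ldots,\alpha_{r-1}$ be sampled uniformly from $\mathbb{Z}_q$, and define $$\alpha_r = s_r\Bigl(\theta-\sum_{i=1}^{r-1}s_i\alpha_i\Bigr)\pmod q .$$ Then $$\sum_{i=1}^r s_i\alpha_i=\theta \pmod q,$$ and therefore $$\prod_{i=1}^r R_Z(2\pi s_i\alpha_i/q)=R_Z(2\pi\theta/q)$$ up to a global phase. Moreover, when the $i$-th visible rotation $R_Z(2\pi\alpha_i/q)$ is applied to a single-qubit state encrypted with a Pauli mask $X^{x_i}Z^{z_i}$ (with $z_i\in\{0,1\}$ arbitrary), the effect on the underlying logical state, under the same mask, is the signed rotation $R_Z(2\pi s_i\alpha_i/q)$; that is, for every single-qubit state vector $|\psi\rangle$, $$R_Z(2\pi\alpha_i/q)\,X^{x_i}Z^{z_i}|\psi\rangle = X^{x_i}Z^{z_i}\,R_Z(2\pi s_i\alpha_i/q)|\psi\rangle .$$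
   Context: $X,Z$ are the single-qubit Pauli matrices and $R_Z(\phi)=e^{-i\phi Z/2}$. For a label $a\in\mathbb{Z}_q$, $R_Z(2\pi a/q)$ denotes the rotation obtained from an integer representative of $a$; changing the representative changes the operator only by a global sign, and operators involving labels are considered up to global phase (in the last displayed identity, $\alpha_i$ is a fixed integer representative and $s_i\alpha_i$ is its integer multiple). All label arithmetic is modulo $q$. Interpretation: the server is instructed to apply the visible rotations $R_Z(2\pi\alpha_i/q)$, $i=1,\dots,r$, to a qubit encrypted under a secret Pauli mask (quantum one-time pad), and the client re-sets the secret $X$-key before the $i$-th rotation to $x_i$. *)

(* Defs.v *)
From HB Require Import structures.
From mathcomp Require Import all_boot all_order all_algebra.
From mathcomp Require Import complex.
From mathcomp Require Import all_classical all_reals all_analysis.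

Set Implicit Arguments.
Unset Strict Implicit.
Unset Printing Implicit Defensive.

Import Order.TTheory GRing.Theory Num.Theory.
Import numFieldNormedType.Exports.

Local Open Scope classical_set_scope.
Local Open Scope ring_scope.
Local Open Scope complex_scope.

(* The limit is taken in the norm topology of matrices over C. *)
Definition expmx (C : numFieldType) (n : nat) (A : 'M[C]_n.+1) : 'M[C]_n.+1 :=
  limn (series (fun k : nat => (k`!%:R)^-1 *: A ^+ k)).

Section Qubit.
Variable R : realType.

Definition pauliX : 'M[R[i]]_2 := \matrix_(i, j) (i != j)%:R.

Definition pauliZ : 'M[R[i]]_2 := \matrix_(i, j) ((-1) ^+ i *+ (i == j)).

Definition RZ (phi : R) : 'M[R[i]]_2 :=
  expmx ((- 'i * (phi / 2)%:C) *: pauliZ).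

(* [qangle q m] is the angle 2 pi m / q; m is an integer, so that a label in
   Z/q only acquires an angle through a choice of representative. *)
Definition qangle (q : nat) (m : int) : R := 2 * pi * m%:~R / q%:R.

Definition eq_up_to_phase (A B : 'M[R[i]]_2) : Prop :=
  exists2 c : R[i], `|c| = 1 & A = c *: B.

Definition is_state (psi : 'cV[R[i]]_2) : Prop :=
  \sum_(k < 2) `|psi k ord0| ^+ 2 = 1.

End Qubit.

(* [m] is an integer representative of the label [a]. For q > 1, 'Z_q is the
   ring of integers mod q. *)
Definition represents (q : nat) (m : int) (a : 'Z_q) : Prop := m%:~R = a.

Definition sgn (b : bool) : int := (-1) ^+ b.

Section Sampling.
Context (R : realType) (d : measure_display) (Omega : measurableType d).
Context (P : probability Omega R) (I A : finType).
Implicit Types (D : pred I) (X : I -> Omega -> A).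

(* Measurability for the discrete sigma-algebra on the finite type A. *)
Definition random_variables D X : Prop :=
  forall i, D i -> forall a : A, measurable (X i @^-1` [set a]).

Definition uniform D X : Prop :=
  forall i, D i -> forall a : A, P (X i @^-1` [set a]) = (#|A|%:R^-1)%:E.

Definition independent D X : Prop :=
  forall (J : {set I}) (a : I -> A), (forall i, i \in J -> D i) ->
    P (\bigcap_(i in [set` J]) (X i @^-1` [set a i])) =
    (\prod_(i in J) P (X i @^-1` [set a i]))%E.

Definition iid_uniform D X : Prop :=
  [/\ random_variables D X, uniform D X & independent D X].

End Sampling.

(* Main.v *)
(* Summing the exponential series entrywise gives
   R_Z(phi) = diag(e^(-i phi/2), e^(i phi/2)), so phi |-> R_Z(phi) is a
   homomorphism with R_Z(2 pi k) = (-1)^k, which turns congruences of labels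
   into equalities up to phase. As R_Z commutes with Z and
   R_Z(phi) X = X R_Z(-phi), moving a rotation past the Pauli mask flips the
   sign of its angle exactly when the X-key is 1. *)

Require Import Defs.
From HB Require Import structures.
From mathcomp Require Import all_boot all_order all_algebra.
From mathcomp Require Import complex ring.
From mathcomp Require Import all_classical all_reals all_analysis.

Set Implicit Arguments.
Unset Strict Implicit.
Unset Printing Implicit Defensive.

Import Order.TTheory GRing.Theory Num.Theory.
Import numFieldNormedType.Exports.

Local Open Scope classical_set_scope.
Local Open Scope ring_scope.
Local Open Scope complex_scope.

(* [R[i] : numFieldType] selects the norm topology; [complex R] carries no
   canonical topology of its own. *)
Lemma complex_cvg (R : realType) (u v : R ^nat) (a b : R) :
  u @ \oo --> a -> v @ \oo --> b ->
  (fun n => u n +i* v n : (R[i] : numFieldType)) @ \oo -->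
    (a +i* b : (R[i] : numFieldType)).
Proof.
move=> /cvgrPdist_lt ua /cvgrPdist_lt vb; apply/cvgrPdist_lt => e e0.
(* A positive element of [R[i]] is real, so the estimate can be carried out in [R], with half of the
   radius for each component. *)
have er : e = (complex.Re e)%:C by rewrite RRe_real // gtr0_real.
have d0 : 0 < complex.Re e / 2 by rewrite divr_gt0 // -ltcR -er.
near=> n.
have -> : (a +i* b) - (u n +i* v n) = (a - u n)%:C + 'i * (b - v n)%:C :> R[i].
  by rewrite [LHS]complexE.
apply: le_lt_trans (ler_normD _ _) _.
rewrite normrM !normc_def /= !(expr0n, expr1n) /= !(addr0, add0r) sqrtr1 mul1r.
rewrite !sqrtr_sqr er -raddfD ltcR (splitr (complex.Re e)).
by apply: ltrD; near: n; [exact: ua|exact: vb].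
Unshelve. all: by end_near. Qed.

Lemma mx_cvg (C : numFieldType) (m n : nat) (u : nat -> 'M[C]_(m, n))
    (A : 'M[C]_(m, n)) :
  (forall i j, (fun k => u k i j) @ \oo --> A i j) -> u @ \oo --> A.
Proof.
move=> uA; apply/cvg_ballP => e e0.
(* Matrix balls are entrywise, and finitely many eventual conditions hold jointly. *)
suff: \forall k \near \oo, forall i j, ball (A i j) e (u k i j).
  by apply: filterS => k; split.
apply: filter_forall => i; apply: filter_forall => j.
by have /cvg_ballP := uA i j; exact.
Qed.

Lemma diag_mxX (R : comNzRingType) (n : nat) (d : 'rV[R]_n.+1) (k : nat) :
  diag_mx d ^+ k = diag_mx (\row_j d ord0 j ^+ k).
Proof.
elim: k => [|k IH].
  by rewrite expr0; apply/matrixP => i j; rewrite !mxE expr0.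
rewrite exprS IH -[_ * _]/(_ *m _) mulmx_diag; congr diag_mx.
by apply/rowP => j; rewrite !mxE exprS.
Qed.

(** Powers of a diagonal matrix are diagonal, so the partial sums are scalar series on the diagonal
    and constantly 0 off it. *)
Lemma expmx_diag (C : numFieldType) (n : nat) (d e : 'rV[C]_n.+1) :
  (forall j,
     series (fun k => (k`!%:R)^-1 * d ord0 j ^+ k) @ \oo --> e ord0 j) ->
  expmx (diag_mx d) = diag_mx e.
Proof.
move=> de; apply/cvg_lim; first exact: norm_hausdorff.
apply: mx_cvg => i j; rewrite mxE.
have -> : (fun k => series (fun k => (k`!%:R)^-1 *: diag_mx d ^+ k) k i j) =
    (fun k => series (fun k => (k`!%:R)^-1 * d ord0 i ^+ k) k *+ (i == j)).
  apply/funext => N; rewrite /series /= summxE -sumrMnl; apply: eq_bigr => k _.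
  by rewrite diag_mxX !mxE mulrnAr.
by case: eqP => _ /=; [exact: de|exact: cvg_cst].
Qed.

(** This is e^(it), given by its components so that the trigonometric identities of [R] apply;
    [cvg_series_cis] links it to the exponential series. *)
Definition cis (R : realType) (t : R) : R[i] := cos t +i* sin t.

Lemma cisD (R : realType) (s t : R) : cis (s + t) = cis s * cis t.
Proof. by rewrite /cis cosD sinD [X in _ +i* X]addrC. Qed.

Lemma cis0 (R : realType) : cis 0 = 1 :> R[i].
Proof. by rewrite /cis cos0 sin0. Qed.

Lemma norm_cis (R : realType) (t : R) : `|cis t| = 1.
Proof. by rewrite normc_def /= cos2Dsin2 sqrtr1. Qed.

Lemma cis_pi_int (R : realType) (k : int) :
  cis (pi * k%:~R) = (-1) ^+ `|k|%N :> R[i].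
Proof.
have cosn n : cos (pi *+ n) = (-1) ^+ n :> R.
  by rewrite -[_ *+ n]add0r (alternatingn (@cosDpi R)) cos0 mulr1.
have sinn n : sin (pi *+ n) = 0 :> R.
  by rewrite -[_ *+ n]add0r (alternatingn (@sinDpi R)) sin0 mulr0.
(* The sign of [k] is split off; it is harmless because cosine is even and the sine vanishes. *)
rewrite [in LHS](intEsign k) rmorphM rmorph_sign mulrCA mulr_sign /= mulr_natr.
case: ifP => _; rewrite /cis ?cosN ?sinN cosn sinn ?oppr0 complexr0;
  by rewrite rmorphXn rmorphN1.
Qed.

(** The two components are shaped like the factors in [cos_coeff] and [sin_coeff]. At [n = 0] the
    truncated predecessor is masked by the factor [odd n]. *)
Lemma expr_i (R : rcfType) (n : nat) :
  'i ^+ n = ((~~ odd n)%:R * (-1) ^+ n./2)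
    +i* ((odd n)%:R * (-1) ^+ n.-1./2) :> R[i].
Proof.
rewrite -[in LHS](odd_double_half n) exprD -mul2n exprM sqr_i.
rewrite -[-1 in LHS](rmorphN1 (real_complex R)) -rmorphXn /=.
case: (boolP (odd n)) => on.
  rewrite (_ : n.-1./2 = n./2); last first.
    by case: n on => //= n /negbTE on; rewrite uphalf_half on.
  rewrite expr1; apply/eqP.
  by rewrite eq_complex /= !(mul0r, mul1r, mulr0, oppr0, add0r) !eqxx.
by rewrite expr0 mul1r !mul1r mul0r.
Qed.

Lemma cvg_series_cis (R : realType) (t : R) :
  (series (fun k => (k`!%:R)^-1 * ('i * t%:C) ^+ k) : nat -> (R[i] : numFieldType))
    @ \oo --> (cis t : (R[i] : numFieldType)).
Proof.
(* The real and imaginary parts of the partial sums are those of the cosine and sine series. *)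
rewrite [X in X @ _ --> _](_ : _ =
  fun n => series (cos_coeff t) n +i* series (sin_coeff t) n); last first.
  apply/funext => n; rewrite /series /=.
  elim: n => [|n IH]; first by rewrite !big_geq.
  rewrite !big_nat_recr //= IH.
  apply/eqP; rewrite exprMn expr_i -rmorphXn.
  rewrite -[_%:R](rmorph_nat (real_complex R)) -fmorphV.
  rewrite eq_complex /=; rewrite /cos_coeff /sin_coeff /= -!exprnP.
  by apply/andP; split; apply/eqP; ring.
apply: complex_cvg.
  (* Unlocking exposes [cos] as the limit of its series, so convergence of the series suffices. *)
  by rewrite unlock; exact: is_cvg_series_cos_coeff.
by rewrite unlock; exact: is_cvg_series_sin_coeff.
Qed.

Lemma RZE (R : realType) (phi : R) :
  RZ phi = diag_mx (\row_(j < 2) cis (- (-1) ^+ j * (phi / 2))).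
Proof.
rewrite /RZ.
have -> : (- 'i * (phi / 2)%:C) *: pauliZ R =
    diag_mx (\row_(j < 2) ('i * (- (-1) ^+ j * (phi / 2))%:C)).
  apply/matrixP => i j; rewrite !mxE mulrnAr; congr (_ *+ _).
  by rewrite !mulNr !(rmorphN, rmorphM) rmorphXn rmorphN1 /=; ring.
by apply: expmx_diag => j; rewrite !mxE; exact: cvg_series_cis.
Qed.

Lemma RZD (R : realType) : {morph @RZ R : s t / s + t >-> s * t}.
Proof.
move=> s t; rewrite !RZE -[RHS]/(_ *m _) mulmx_diag; congr diag_mx.
by apply/rowP => j; rewrite !mxE -cisD -mulrDr mulrDl.
Qed.

Lemma RZ0 (R : realType) : RZ 0 = 1 :> 'M[R[i]]_2.
Proof.
by rewrite RZE; apply/matrixP => i j; rewrite !mxE mul0r mulr0 cis0.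
Qed.

Lemma RZ_2pi_int (R : realType) (k : int) :
  RZ (2 * pi * k%:~R) = ((-1) ^+ `|k|%N)%:M :> 'M[R[i]]_2.
Proof.
rewrite RZE; apply/matrixP => i j; rewrite !mxE; congr (_ *+ _).
(* The two diagonal angles are opposite multiples of pi with the same parity, hence the matrix is
   scalar. *)
have -> : - (-1) ^+ i * (2 * pi * k%:~R / 2) = pi * ((-1) ^+ i.+1 * k)%:~R :> R.
  by rewrite rmorphM rmorphXn /= exprS rmorphN1; field.
by rewrite cis_pi_int abszMsign.
Qed.

Lemma qangleD (R : realType) (q : nat) : {morph qangle R q : m n / m + n}.
Proof. by move=> m n; rewrite /qangle rmorphD /= mulrDr mulrDl. Qed.

Lemma qangle_sum (R : realType) (q : nat) (I : finType) (m : I -> int) :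
  \sum_i qangle R q (m i) = qangle R q (\sum_i m i).
Proof.
rewrite (big_morph _ (@qangleD R q) (_ : qangle R q 0 = 0)) //.
by rewrite /qangle mulr0 mul0r.
Qed.

Lemma intr_Zp_eq0 (q : nat) (n : int) :
  (1 < q)%N -> (n%:~R == 0 :> 'Z_q) = (q %| n)%Z.
Proof.
(* The residue is computed by [val_Zp_nat] for naturals only; dropping the sign affects neither
   vanishing nor divisibility. *)
move=> q1; rewrite {1}[n]intEsign rmorphM rmorph_sign mulr_sign.
rewrite (_ : (if _ then _ else _) == 0 = (`|n|%N%:R == 0 :> 'Z_q)); last first.
  by case: ifP; rewrite ?oppr_eq0.
by rewrite -val_eqE /= val_Zp_nat.
Qed.

Lemma RZ_eq_up_to_phase (R : realType) (q : nat) (s t : int) (a : 'Z_q) :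
  (1 < q)%N -> represents s a -> represents t a ->
  eq_up_to_phase (RZ (qangle R q s)) (RZ (qangle R q t)).
Proof.
move=> q1 sa ta.
have /dvdzP[k sk] : (q %| s - t)%Z.
  by rewrite -intr_Zp_eq0 // rmorphB /= sa ta subrr.
have -> : s = k * q + t by rewrite -sk subrK.
(* Shifting the representative by [k * q] adds 2 pi k to the angle, which contributes this phase. *)
exists ((-1) ^+ `|k|%N); first by rewrite normrX normrN1 expr1n.
rewrite qangleD RZD.
rewrite (_ : qangle R q (k * q) = 2 * pi * k%:~R); last first.
  by rewrite /qangle rmorphM /= mulrA mulfK // pnatr_eq0 -lt0n ltnW.
by rewrite RZ_2pi_int -[_ * _]/(_ *m _) mul_scalar_mx.
Qed.

Lemma pauliZE (R : realType) : pauliZ R = diag_mx (\row_(j < 2) (-1) ^+ j).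
Proof. by apply/matrixP => i j; rewrite !mxE. Qed.

Lemma RZ_comm_pauliZ (R : realType) (phi : R) : GRing.comm (RZ phi) (pauliZ R).
Proof.
rewrite RZE pauliZE /GRing.comm -[LHS]/(_ *m _) -[RHS]/(_ *m _) !mulmx_diag.
by congr diag_mx; apply/rowP => j; rewrite !mxE mulrC.
Qed.

Lemma RZ_pauliX (R : realType) (phi : R) :
  RZ phi * pauliX R = pauliX R * RZ (- phi).
Proof.
rewrite !RZE -[LHS]/(_ *m _) -[RHS]/(_ *m _) mul_diag_mx mul_mx_diag.
apply/matrixP => i j; rewrite !mxE mulrC.
have [->|ij] := eqVneq i j; first by rewrite !mul0r.
(* Off the diagonal the indices are 0 and 1 in some order, so their signs are opposite. *)
have -> : (-1) ^+ j = - (-1) ^+ i :> R.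
  case: i j ij => [[|[|//]] ?] [[|[|//]] ?] //= _;
    by rewrite expr0 expr1 ?opprK.
by congr (_ * cis _); ring.
Qed.

Lemma RZ_pauli_mask (R : realType) (phi : R) (x z : bool) :
  RZ phi * (pauliX R ^+ x * pauliZ R ^+ z) =
  pauliX R ^+ x * pauliZ R ^+ z * RZ ((-1) ^+ x * phi).
Proof.
have XRZ : RZ phi * pauliX R ^+ x = pauliX R ^+ x * RZ ((-1) ^+ x * phi).
  by case: x; rewrite ?mulr1 ?mul1r ?expr1 ?mulN1r // RZ_pauliX.
rewrite mulrA XRZ -!mulrA; congr (_ * _).
exact/commrX/RZ_comm_pauliZ.
Qed.

Lemma mulrz_sgnK (V : zmodType) (b : bool) (v : V) : v *~ sgn b *~ sgn b = v.
Proof. by rewrite -mulrzA -expr2 sqrr_sign. Qed.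

(** The square of a sign is 1, so the signed last label is [theta] minus the other signed labels,
    and the sum telescopes. *)
Lemma sum_signed_labels (V : zmodType) (n : nat) (theta : V) (b : 'I_n -> bool)
    (a : 'I_n -> V) (l : 'I_n) : nat_of_ord l = n.-1 ->
  a l = (theta - \sum_(i < n | (i < l)%N) a i *~ sgn (b i)) *~ sgn (b l) ->
  \sum_(i < n) a i *~ sgn (b i) = theta.
Proof.
move=> ln al; rewrite (bigD1 l) //= al mulrz_sgnK.
rewrite [X in _ + X](eq_bigl (fun i : 'I_n => (i < l)%N)) ?subrK // => i.
rewrite -val_eqE /= ltn_neqAle ln -ltnS prednK ?ltn_ord ?andbT //.
(* Cancelling the predecessor needs [0 < n], which holds since ['I_n] has the element [i]. *)
by case: (n) i => [[]|].
Qed.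

Theorem proposition5p1 (R : realType) (p r : nat) (hp : (1 <= p)%N)
    (hr : (2 <= r)%N) (theta : 'Z_(2 ^ p))
    (d : measure_display) (Omega : measurableType d) (P : probability Omega R)
    (x : 'I_r -> Omega -> bool) (alpha : 'I_r -> Omega -> 'Z_(2 ^ p))
    (last : 'I_r) (hlast : nat_of_ord last = r.-1)
    (hx : iid_uniform P (fun _ : 'I_r => true) x)
    (halpha : iid_uniform P (fun i : 'I_r => (i < last)%N) alpha)
    (hlast_alpha : forall w : Omega,
       alpha last w =
         (theta - \sum_(i < r | (i < last)%N) alpha i w *~ sgn (x i w))
           *~ sgn (x last w)) :
  forall w : Omega,
    [/\ \sum_(i < r) alpha i w *~ sgn (x i w) = theta,
        forall (m : 'I_r -> int) (t : int),
          (forall i : 'I_r, represents (m i) (alpha i w *~ sgn (x i w))) ->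
          represents t theta ->
          eq_up_to_phase (\prod_(i < r) RZ (qangle R (2 ^ p) (m i)))
                         (RZ (qangle R (2 ^ p) t))
      & forall (i : 'I_r) (a : int), represents a (alpha i w) ->
          forall (z : bool) (psi : 'cV[R[i]]_2), is_state psi ->
            RZ (qangle R (2 ^ p) a) *m
              (pauliX R ^+ x i w *m pauliZ R ^+ z *m psi) =
            pauliX R ^+ x i w *m pauliZ R ^+ z *m
              (RZ (qangle R (2 ^ p) (sgn (x i w) * a)) *m psi)].
Proof.
move=> w.
have q1 : (1 < 2 ^ p)%N by rewrite -{1}(expn0 2) ltn_exp2l.
have sum_theta := sum_signed_labels hlast (hlast_alpha w).
split=> [//|m t mP tP|i a _ z psi _].
(* The product is one rotation whose integer label, the sum of the [m i], represents [theta]; only a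
   change of representative remains. *)
- rewrite -(big_morph _ (@RZD R) (@RZ0 R)) qangle_sum.
  apply: RZ_eq_up_to_phase q1 _ tP; rewrite /represents rmorph_sum /= -sum_theta.
  by apply: eq_bigr => i _; exact: mP.
- have -> : qangle R (2 ^ p) (sgn (x i w) * a) =
      (-1) ^+ x i w * qangle R (2 ^ p) a.
    by rewrite /qangle rmorphM rmorph_sign /= mulrCA !mulrA.
  (* Reassociating isolates [psi] and leaves an identity of operators. *)
  by rewrite [LHS]mulmxA [RHS]mulmxA; congr (_ *m psi); exact: RZ_pauli_mask.
Qed.
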